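(* Let $n$ be an even positive integer and let $\mathrm{F}_1(n)$ be the family of all $1$-factors (perfect matchings) of the complete graph $K_n$. Then $\mathrm{poly}_{\mathrm{F}_1}(K_n)=\lfloor \log_2 n\rfloor$.
   Context: For a graph $G$ and a family $\mathcal{H}$ of subgraphs of $G$, an edge-coloring of $G$ is $\mathcal{H}$-polychromatic if every graph in $\mathcal{H}$ contains, on its edges, every color that is used on the edges of $G$. The $\mathcal{H}$-polychromatic number $\mathrm{poly}_{\mathcal{H}}(G)$ is the largest number of colors used in an $\mathcal{H}$-polychromatic edge-coloring of $G$. *)

(* Defs.v *)
From mathcomp Require Import all_boot.

Set Implicit Arguments.
Unset Strict Implicit.
Unset Printing Implicit Defensive.

Record sgraph := SGraph {
  vertex :> finType;
  adj : rel vertex;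
  adj_sym : symmetric adj;
  adj_irr : irreflexive adj
}.

Definition edges (G : sgraph) : {set {set G}} :=
  [set e | [exists x, exists y, adj x y && (e == [set x; y])]].

Definition complete_adj (n : nat) : rel 'I_n := fun x y => x != y.

Lemma complete_adj_sym n : symmetric (@complete_adj n).
Proof. by move=> x y; rewrite /complete_adj eq_sym. Qed.

Lemma complete_adj_irr n : irreflexive (@complete_adj n).
Proof. by move=> x; rewrite /complete_adj eqxx. Qed.

Definition complete (n : nat) : sgraph :=
  SGraph (@complete_adj_sym n) (@complete_adj_irr n).

(* A pair (vertex set, edge set) whose edges are edges of G with both ends in
   the vertex set. *)
Definition is_subgraph (G : sgraph) (S : {set G} * {set {set G}}) : bool :=
  (S.2 \subset edges G) && [forall e in S.2, e \subset S.1].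

Definition subgraph (G : sgraph) : finType :=
  {S : {set G} * {set {set G}} | is_subgraph S}.

Definition sub_vertices (G : sgraph) (S : subgraph G) : {set G} := (val S).1.
Definition sub_edges (G : sgraph) (S : subgraph G) : {set {set G}} := (val S).2.

Definition is_factor (G : sgraph) (k : nat) (S : subgraph G) : bool :=
  (sub_vertices S == [set: G]) &&
  [forall v : G, #|[set e in sub_edges S | v \in e]| == k].

Definition factors (k : nat) (G : sgraph) : {set subgraph G} :=
  [set S | is_factor k S].

(* Colors are natural numbers: G is finite, so this is no restriction. An
   edge-coloring is a function on all vertex sets of which only the values on
   [edges G] matter. *)
Definition coloring (G : sgraph) := {set G} -> nat.

Definition colors_used (G : sgraph) (c : coloring G) : seq nat :=
  undup [seq c e | e in edges G].

Definition polychromatic (G : sgraph) (H : {set subgraph G})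
    (c : coloring G) : Prop :=
  forall S, S \in H -> forall a, a \in colors_used c ->
    exists2 e, e \in sub_edges S & c e = a.

(* Relational form of poly_H(G) = k: k is the largest number of colors used. *)
Definition is_poly_number (G : sgraph) (H : {set subgraph G})
    (k : nat) : Prop :=
  (exists2 c : coloring G, polychromatic H c & size (colors_used c) = k) /\
  (forall c : coloring G, polychromatic H c -> size (colors_used c) <= k).

(* Main.v *)
(* Lower bound: order the vertices and give an edge the color of its last
   endpoint, where color [a] occupies [2 ^ a] consecutive vertices followed by
   only [2 ^ a - 1] others; a perfect matching cannot send the whole block to
   its followers, so it has an edge of color [a].

   Upper bound: deleting the edges of color [i] leaves no perfect matching, so
   Tutte's theorem gives a barrier [S_i] whose complement has at least
   [|S_i| + 2] components, with all edges between them of color [i]. Two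
   disjoint complete multipartite graphs on the same vertices cannot both be
   nontrivial, so the larger of two barriers covers all but one component of
   the smaller one. The uncovered component does not depend on the larger
   barrier, so the vertices [B_i] outside [S_i] that lie in every larger
   barrier number at least [|S_i| + 1]. The [B_i] are pairwise disjoint and
   [B_i] lies in the larger barriers, so the sizes at least double at each step,
   whence [2 ^ k - 1 <= n] for [k] colors, and [2 ^ k <= n] as [n] is even. *)

Require Import Defs.
From mathcomp Require Import all_boot perm zify.

Set Implicit Arguments.
Unset Strict Implicit.
Unset Printing Implicit Defensive.

Lemma exists_neq (T : finType) (A : {set T}) x :
  1 < #|A| -> exists2 y, y \in A & y != x.
Proof.
case/card_gt1P=> y [z [yA zA yz]]; have [yx | yx] := eqVneq y x; last by exists y.
by exists z; rewrite // -yx eq_sym.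
Qed.

(** * Matchings and exchanges of their edges *)

Section Matching.

Variable V : finType.
Implicit Types (E : {set {set V}}) (f g : V -> V) (u v x y z : V).

(** A matching is encoded as the involution that swaps the ends of each of its edges, so that
    unmatched vertices are fixed points. *)
Definition matching E f :=
  [forall x, (f (f x) == x) && ((f x != x) ==> ([set x; f x] \in E))].

Definition exposed f := [set x | f x == x].

Definition perfect E :=
  [exists f : {ffun V -> V}, matching E f && (exposed f == set0)].

Definition maximum E f :=
  matching E f /\ forall g, matching E g -> #|exposed f| <= #|exposed g|.

Lemma matchingP E f :
  reflect ((forall x, f (f x) = x) /\
           (forall x, f x != x -> [set x; f x] \in E))
          (matching E f).
Proof.
apply: (iffP forallP) => [fE | [ff fE] x]; last first.
  by rewrite ff eqxx; apply/implyP/fE.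
by split=> x; have /andP[/eqP ? /implyP] := fE x.
Qed.

Lemma eq_matching E f g : f =1 g -> matching E f = matching E g.
Proof. by move=> fg; apply: eq_forallb => x; rewrite !fg. Qed.

Lemma eq_exposed f g : f =1 g -> exposed f = exposed g.
Proof. by move=> fg; apply/setP => x; rewrite !inE fg. Qed.

Lemma perfectP E :
  reflect (exists2 f, matching E f & exposed f = set0) (perfect E).
Proof.
apply: (iffP existsP) => [[f /andP[Ef /eqP f0]] | [f Ef f0]]; first by exists f.
exists (finfun f); rewrite (eq_matching E (ffunE f)) Ef.
by rewrite (eq_exposed (ffunE f)) f0 eqxx.
Qed.

Lemma maximum_exists E : exists f, maximum E f.
Proof.
have idE : matching E (finfun id).
  by apply/matchingP; split=> x; rewrite !ffunE ?eqxx.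
pose P (f : {ffun V -> V}) := matching E f.
case: (@arg_minnP _ _ P (fun f : {ffun V -> V} => #|exposed f|) idE) => f Ef minf.
exists f; split=> // g Eg; rewrite -(eq_exposed (ffunE g)).
by apply: minf; rewrite /P (eq_matching E (ffunE g)).
Qed.

Lemma odd_exposed E f : matching E f -> odd #|exposed f| = odd #|V|.
Proof.
case/matchingP=> ff _; pose r := @enum_rank V.
(* Along an arbitrary enumeration, each matched pair has its first end in [A] and its second in
   [B]. *)
pose A := [set x | r x < r (f x)]; pose B := [set x | r (f x) < r x].
have cAB : #|A| = #|B|.
  rewrite -(card_preimset B (can_inj ff)); congr #|pred_of_set _|.
  by apply/setP => x; rewrite !inE ff.
have dAB : [disjoint A & B].
  by rewrite -setI_eq0; apply/eqP/setP => x; rewrite !inE; lia.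
have AUB : ~: exposed f = A :|: B.
  apply/setP => x; rewrite !inE -neq_ltn; congr (~~ _).
  by rewrite eq_sym (inj_eq val_inj) (inj_eq enum_rank_inj).
rewrite -(cardsC (exposed f)) AUB.
by move/leqifP: (leq_card_setU A B); rewrite dAB => /eqP ->; lia.
Qed.

Lemma exposed_gt1 E f :
  ~~ odd #|V| -> ~~ perfect E -> matching E f -> 1 < #|exposed f|.
Proof.
move=> evV nE Ef; have := odd_exposed Ef; rewrite (negPf evV).
case: (posnP #|exposed f|) => [/eqP|]; last by case: #|_| => [|[]].
rewrite cards_eq0 => /eqP f0; case/negP: nE; apply/perfectP; by exists f.
Qed.

Lemma exposed_nonadj E f u v :
  maximum E f -> u \in exposed f -> v \in exposed f -> u != v ->
  [set u; v] \notin E.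
Proof.
case=> /matchingP[ff fE] minf; rewrite !inE => /eqP fu /eqP fv uv.
apply/negP => uvE; pose g x := f (tperm u v x).
have gg : matching E g.
  apply/matchingP; rewrite /g; split=> x;
    case: (tpermP u v x) => [->|->|/eqP xu /eqP xv].
  - by rewrite fv tpermR fu.
  - by rewrite fu tpermL fv.
  - rewrite tpermD ?ff //; apply/eqP => h; [case/eqP: xu | case/eqP: xv];
    by rewrite -(ff x) -h.
  - by rewrite fv.
  - by rewrite fu setUC.
  - exact: fE.
have := minf _ gg; rewrite leqNgt; case/negP; apply: proper_card.
apply/properP; split; last first.
  by exists u; rewrite ?inE /g ?tpermL ?fu ?fv // eq_sym.
apply/subsetP => x; rewrite !inE /g; case: tpermP => // ->; rewrite ?fu ?fv //.
Qed.

(** Conjugation by a transposition: for exposed [u] and matched [v], the edge from [v] to [f v] is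
    replaced by the one from [v] to [u], so that [f v] becomes exposed instead of [u]. *)
Definition exchange f u v x := tperm u (f v) (f (tperm u (f v) x)).

Lemma exposed_exchange f u v :
  exposed (exchange f u v) = tperm u (f v) @^-1: exposed f.
Proof.
apply/setP => x; rewrite !inE /exchange.
by rewrite -(inj_eq (@perm_inj _ (tperm u (f v)))) tpermK.
Qed.

Lemma matching_exchange E f u v :
  matching E f -> u \in exposed f -> f v != v -> [set u; v] \in E ->
  matching E (exchange f u v).
Proof.
case/matchingP=> ff fE; rewrite inE => /eqP fu fvv uvE.
have uv : u != v by apply: contra_neq fvv => <-.
have fvu : f v != u by apply: contraNneq uv => h; rewrite -fu -h ff.
apply/matchingP; rewrite /exchange; split=> x; first by rewrite tpermK ff tpermK.
case: (tpermP u (f v) x) => [->|->|/eqP xu /eqP xv].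
- by rewrite ff tpermD // eq_sym.
- by rewrite fu tpermL eqxx.
have fxu : u != f x by apply: contra_neq xu => h; rewrite -(ff x) -h fu.
case: (eqVneq x v) => [->|xv']; first by rewrite tpermR setUC.
have fxv : f v != f x by apply: contra_neq xv' => h; rewrite -(ff x) -h ff.
by rewrite tpermD //; apply: fE.
Qed.

Lemma maximum_exchange E f u v :
  maximum E f -> u \in exposed f -> f v != v -> [set u; v] \in E ->
  maximum E (exchange f u v).
Proof.
move=> [Ef minf] fu fv uvE; split; first exact: matching_exchange.
by move=> g /minf; rewrite exposed_exchange card_preimset //; apply: perm_inj.
Qed.

(** * Universal vertices, edge-maximal graphs and Tutte's theorem *)

Definition universal E := [set v | [forall x, (x != v) ==> ([set v; x] \in E)]].

Lemma universalP E v :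
  reflect (forall x, x != v -> [set v; x] \in E) (v \in universal E).
Proof. by rewrite inE; apply: (iffP forallP) => h x; apply/implyP/h. Qed.

(** A second exposed vertex [w] can be exchanged at [s]; this exposes [f s] while [u] stays exposed,
    and exposed vertices of a maximum matching are nonadjacent. *)
Lemma mate_exposed_nonadj E f u s :
  maximum E f -> 1 < #|exposed f| -> u \in exposed f -> s \in universal E ->
  f s != s -> (u != f s) && ([set u; f s] \notin E).
Proof.
move=> fM fc fu /universalP sU fs; have [/matchingP[ff fE] _] := fM.
have ufs : u != f s.
  move: fu; rewrite inE; apply: contraTneq => ->; by rewrite ff eq_sym.
have [w fw wu] := exists_neq u fc.
have ws : w != s by apply: contraNneq fs => <-; move: fw; rewrite inE.
have fsw : f s != w.
  by move: fw; rewrite inE; apply: contraTneq => <-; rewrite ff eq_sym.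
rewrite ufs /=; apply: (@exposed_nonadj E (exchange f w s)) => //.
- by apply: maximum_exchange => //; rewrite setUC; apply: sU.
- by rewrite exposed_exchange inE tpermD // eq_sym.
- by rewrite exposed_exchange inE tpermR.
Qed.

Lemma independent_set E :
  ~~ odd #|V| -> ~~ perfect E ->
  exists T : {set V},
    [/\ #|universal E| + 2 <= #|T|, [disjoint T & universal E] &
        {in T &, forall x y, x != y -> [set x; y] \notin E}].
Proof.
move=> evV nE; have [f fM] := maximum_exists E; have [Ef _] := fM.
have fc := exposed_gt1 evV nE Ef; have [ff fE] := matchingP _ _ Ef.
have Uf s : s \in universal E -> f s != s.
  move=> /universalP sU; apply/negP => fs.
  have [w fw ws] := exists_neq s fc.
  have := exposed_nonadj fM (u := s) (v := w); rewrite inE => /(_ fs fw).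
  by rewrite eq_sym ws sU // => /(_ isT).
have Nf := mate_exposed_nonadj fM fc.
have dU : [disjoint exposed f & f @: universal E].
  apply/pred0P => x /=; apply/negP => /andP[fx /imsetP[s sU xs]].
  by have := Nf _ _ fx sU (Uf _ sU); rewrite xs eqxx.
have fU s : s \in universal E -> f s \notin universal E.
  move=> sU; apply/negP => fsU.
  have [x fx _] := exists_neq s fc.
  have := Nf _ _ fx sU (Uf _ sU) => /andP[xfs]; case/negP.
  by rewrite setUC; move/universalP: fsU; apply.
(* At least two vertices are exposed, and each universal vertex contributes its mate. *)
exists (exposed f :|: f @: universal E); split.
- move/leqifP: (leq_card_setU (exposed f) (f @: universal E)).
  rewrite dU => /eqP ->; rewrite (card_imset _ (can_inj ff)); lia.
- apply/pred0P => x /=; apply/negP => /andP[] /setUP[fx | /imsetP[s sU ->]].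
    by move/Uf; move: fx; rewrite inE => ->.
  by rewrite (negPf (fU _ sU)).
move=> x y /setUP[fx | /imsetP[s sU ->]] /setUP[fy | /imsetP[s' s'U ->]] xy.
- exact: exposed_nonadj fM fx fy xy.
- by have /andP[] := Nf _ _ fx s'U (Uf _ s'U).
- by have /andP[] := Nf _ _ fy sU (Uf _ sU); rewrite setUC.
(* For two mates [f s] and [f s'], an exchange at [s] first exposes [f s], which reduces to the case
   of an exposed vertex and a mate. *)
case/card_gt1P: fc => u [v [fu fv uv]].
have us : u != s by apply: contraTneq fu => ->; rewrite inE Uf.
have us' : u != s' by apply: contraTneq fu => ->; rewrite inE Uf.
have gM : maximum E (exchange f u s).
  by apply: maximum_exchange; rewrite ?Uf // setUC; move/universalP: sU; apply.
have ss' : s' != f s by apply: contraNneq (fU _ sU) => <-.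
have fsf : f s != f s' := xy.
have ufs : u != f s'.
  by have /andP[] := Nf _ _ fu s'U (Uf _ s'U).
have gs' : exchange f u s s' = f s'.
  by rewrite /exchange !(@tpermD _ u (f s)) // eq_sym.
have gc : 1 < #|exposed (exchange f u s)|.
  rewrite exposed_exchange card_preimset; last exact: perm_inj.
  by apply/card_gt1P; exists u, v.
have := @mate_exposed_nonadj E (exchange f u s) (f s) s' gM gc.
rewrite gs' exposed_exchange inE tpermR fu s'U Uf // => /(_ isT isT isT).
by case/andP.
Qed.

(* Exchanging makes [f] agree with [f0] on more and more vertices, until the
   exposed vertex [z] becomes a neighbour of [b]. *)
Lemma two_near_perfect E f0 f a c b z :
  ~~ odd #|V| -> ~~ perfect E ->
  matching E f0 -> exposed f0 = [set a; c] -> [set a; b] \in E ->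
  [set c; b] \in E -> matching E f -> b != z -> exposed f = [set b; z] -> False.
Proof.
move=> evV nE Ef0 f0ac abE cbE.
have [m] := ubnP #|[set x | f x != f0 x]|.
elim: m f z => // m IHm f z; rewrite ltnS => lem Ef bz fbz.
have fM : maximum E f.
  split=> // g Eg; rewrite fbz cards2 bz; exact: (exposed_gt1 evV nE Eg).
have fb : b \in exposed f by rewrite fbz !inE eqxx.
have fz : z \in exposed f by rewrite fbz !inE eqxx orbT.
have := exposed_nonadj fM fb fz bz => bzE.
have [ff fE] := matchingP _ _ Ef; have [ff0 f0E] := matchingP _ _ Ef0.
(* The vertices exposed by [f0] are neighbours of [b], and [z] is not. *)
have z0 : f0 z != z.
  have : z \notin exposed f0; last by rewrite inE.
  by rewrite f0ac !inE; apply: contra bzE => /orP[] /eqP ->; rewrite setUC.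
set y := f0 z in z0; have zyE : [set z; y] \in E by apply: f0E.
have yb : y != b by apply: contraNneq bzE => <-; rewrite setUC.
have fy : f y != y.
  have : y \notin exposed f; last by rewrite inE.
  by rewrite fbz !inE negb_or yb z0.
move/setP: (fbz) => fbz'; have := fbz' b; have := fbz' z.
rewrite !inE !eqxx orbT /= => /eqP fzz /eqP fbb.
have fyz : f y != z by apply: contra_neq z0 => h; rewrite -fzz -h ff.
have fyb : f y != b by apply: contra_neq yb => h; rewrite -fbb -h ff.
apply: (IHm (exchange f z y) (f y)).
- apply: leq_trans lem; apply: proper_card; apply/properP; split; last first.
    exists z; rewrite !inE; first by rewrite fzz eq_sym.
    by rewrite /exchange tpermL ff tpermD ?eqxx // eq_sym.
  apply/subsetP => x; rewrite !inE /exchange; case: (tpermP z (f y) x) => [->|->|].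
  + by move=> _; rewrite fzz eq_sym.
  + move=> _; apply: contraNneq fyz; rewrite ff => /(congr1 f0).
    by rewrite !ff0 => <-.
  move=> /eqP xz /eqP xfy; case: (eqVneq x y) => [->|xy].
    by rewrite tpermR /y ff0 eqxx.
  rewrite tpermD //.
    by apply: contra_neq xz => h; rewrite -(ff x) -h fzz.
  by apply: contra_neq xy => h; rewrite -(ff x) -h ff.
- exact: matching_exchange.
- by rewrite eq_sym.
apply/setP => x; rewrite exposed_exchange fbz !inE.
case: (tpermP z (f y) x) => [->|->|/eqP xz /eqP xfy].
- by rewrite (negPf fyb) (negPf fyz) !(eq_sym z) (negPf bz) (negPf fyz).
- by rewrite !eqxx !orbT.
by rewrite (negPf xz) (negPf xfy).
Qed.

(** A perfect matching of the enlarged graph must use the new edge; deleting that edge exposes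
    exactly its ends. *)
Lemma near_perfect E a c :
  ~~ perfect E -> a != c -> perfect ([set a; c] |: E) ->
  exists2 f, matching E f & exposed f = [set a; c].
Proof.
move=> nE ac /perfectP[g /matchingP[gg gE] g0].
have gx x : g x != x.
  by apply/negP => gxx; have := in_set0 x; rewrite -g0 inE gxx.
have [gac | gac] := eqVneq (g a) c; last first.
  case/negP: nE; apply/perfectP; exists g => //; apply/matchingP; split=> // x hx.
  have /setU1P[/setP xac | //] := gE x hx.
  have := xac a; have := xac c; rewrite !inE !eqxx orbT /=.
  case/orP=> /eqP cx /orP[] /eqP ax.
  - by rewrite cx ax eqxx in ac.
  - by case/eqP: gac; rewrite ax gg cx.
  - by case/eqP: gac; rewrite ax cx.
  - by rewrite cx ax eqxx in ac.
have gca : g c = a by rewrite -gac gg.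
exists (fun x => g (tperm a c x)).
  apply/matchingP; split=> x; case: (tpermP a c x) => [->|->|/eqP xa /eqP xc].
  - by rewrite gca tpermL.
  - by rewrite gac tpermR.
  - rewrite tpermD ?gg //; first by rewrite -gca (inj_eq (can_inj gg)) eq_sym.
    by rewrite -gac (inj_eq (can_inj gg)) eq_sym.
  - by rewrite gca eqxx.
  - by rewrite gac eqxx.
  - move=> hx; have /setU1P[/setP/(_ x) | //] := gE x hx.
    by rewrite !inE eqxx (negPf xa) (negPf xc).
apply/setP => x; rewrite !inE; case: (tpermP a c x) => [->|->|/eqP xa /eqP xc].
- by rewrite gca !eqxx.
- by rewrite gac !eqxx orbT.
by rewrite (negPf (gx x)) (negPf xa) (negPf xc).
Qed.

(** Let [d] be a nonneighbour of [b]. Were [ac] missing too, maximality would give matchings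
    exposing exactly [a, c] and exactly [b, d], which [two_near_perfect] excludes. Hence the graph
    without its universal vertices is a disjoint union of cliques. *)
Lemma maximal_trans E a b c :
  ~~ odd #|V| -> maxset (fun E => ~~ perfect E) E ->
  b \notin universal E -> [set a; b] \in E -> [set b; c] \in E ->
  a != c -> [set a; c] \in E.
Proof.
move=> evV /maxsetP[nE maxE] /universalP bU abE bcE ac.
have addP x y : [set x; y] \notin E -> perfect ([set x; y] |: E).
  move=> xyE; apply: contraNT xyE => nxy.
  by rewrite -(maxE _ nxy (subsetUr _ _)) setU11.
apply/negPn/negP => acE.
have [f0 Ef0 f0ac] := near_perfect nE ac (addP _ _ acE).
have [d db bdE] : exists2 d, d != b & [set b; d] \notin E.
  have : ~~ [forall d, (d != b) ==> ([set b; d] \in E)].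
    by apply/forallP => h; apply: bU => d; apply/implyP/h.
  by case/forallPn => d; rewrite negb_imply => /andP[]; exists d.
have bd : b != d by rewrite eq_sym.
have [f Ef fbd] := near_perfect nE bd (addP _ _ bdE).
by apply: (two_near_perfect evV nE Ef0 f0ac abE _ Ef bd fbd); rewrite setUC.
Qed.

(* Tutte's theorem: [p] labels the vertices outside [S] by their component, and
   components are counted regardless of parity. *)
Lemma tutte_barrier E0 :
  ~~ odd #|V| -> ~~ perfect E0 ->
  exists S : {set V}, exists p : V -> {set V},
    #|S| + 2 <= #|p @: ~: S| /\
    forall x y, x \notin S -> y \notin S -> p x != p y -> [set x; y] \notin E0.
Proof.
move=> evV nE0; have [E EM sE0] := maxset_exists (P := fun E => ~~ perfect E) nE0.
have [nE _] := maxsetP EM.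
have [T [cT dT iT]] := independent_set evV nE.
(* Components outside the universal vertices are cliques, so a closed neighbourhood can serve as the
   label of a component. *)
exists (universal E), (fun x => [set y | (y == x) || ([set x; y] \in E)]); split.
  apply: leq_trans cT _; set p := (fun x => _).
  have pT : {in T &, injective p}.
    move=> x y xT yT /setP/(_ x); rewrite !inE eqxx /=.
    by case: eqVneq => //= xy /esym; rewrite setUC (negPf (iT _ _ xT yT xy)).
  rewrite -(card_in_imset pT); apply/subset_leq_card/imsetS.
  by rewrite -disjoints_subset.
move=> x y xU yU; apply: contraNN => /(subsetP sE0) xyE.
apply/eqP/setP => z; rewrite !inE.
have [->|zx] := eqVneq z x; first by rewrite /= setUC xyE orbT.
have [->|zy] := eqVneq z y; first by rewrite xyE.
apply/idP/idP => [xzE | yzE] /=.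
- by apply: (maximal_trans evV EM xU); rewrite // 1?setUC // eq_sym.
- by apply: (maximal_trans evV EM yU xyE yzE); rewrite eq_sym.
Qed.

End Matching.

(** * Barriers of different colors and the doubling of their sizes *)

Lemma pow2_le_sum k (s : 'I_k -> nat) m :
  injective s -> (forall j, \sum_(i | s i < s j) (s i).+1 <= s j) ->
  2 ^ #|[set i | s i < m]| <= (\sum_(i | s i < m) (s i).+1).+1.
Proof.
move=> inj_s ge_s; elim: m => [|m IHm].
  by rewrite (_ : [set i | _] = set0) ?cards0 //; apply/setP => i; rewrite !inE.
have [j sj | ns] := pickP (fun j => s j == m).
  have eqE i : (s i < m.+1) = (s i < m) || (i == j).
    by rewrite ltnS leq_eqVlt orbC -(eqP sj) (inj_eq inj_s).
  have -> : [set i | s i < m.+1] = j |: [set i | s i < m].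
    by apply/setP => i; rewrite !inE eqE orbC.
  rewrite cardsU1 inE (eqP sj) ltnn (bigD1 j) ?eqE ?eqxx ?orbT //=.
  rewrite (eq_bigl (fun i => s i < m)); last first.
    move=> i; rewrite eqE; case: eqVneq => [->|]; rewrite ?andbT ?orbF //.
    by rewrite (eqP sj) ltnn.
  (* [s j] is at least the sum over the smaller values, so the new term [(s j).+1] at least doubles
     that sum plus one. *)
  rewrite expnS mul2n -addnn; apply: leq_trans (leq_add IHm IHm) _.
  by rewrite addSn addnS addSn !ltnS leq_add2r -(eqP sj).
have eqE i : (s i < m.+1) = (s i < m) by rewrite ltnS leq_eqVlt ns.
by under eq_finset do rewrite eqE; under eq_bigl do rewrite eqE.
Qed.

Section Barriers.

Variables (V C : finType) (k : nat) (S : 'I_k -> {set V}) (p : 'I_k -> V -> C).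

Hypothesis many : forall i, #|S i| + 2 <= #|p i @: ~: S i|.
Hypothesis separate : forall i j x y, i != j ->
  x \notin S i :|: S j -> y \notin S i :|: S j ->
  p i x != p i y -> p j x = p j y.

Lemma many_setC i : #|S i| + 2 <= #|~: S i|.
Proof. exact: leq_trans (many i) (leq_imset_card _ _). Qed.

(** All labels of [p i] but at most one then occur on [S j], hence [#|S i| + 2 <= #|S j| + 1]. *)
Lemma lt_of_const i j :
  {in ~: (S i :|: S j) &, forall x y, p i x = p i y} -> #|S i| < #|S j|.
Proof.
move=> pc; have := many i; rewrite -(setID (~: S i) (S j)) setDE -setCU imsetU.
set A := p i @: _; set B := p i @: _ => le_AB.
have A_le : #|A| <= #|S j|.
  by apply: leq_trans (leq_imset_card _ _) (subset_leq_card (subsetIr _ _)).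
have B_le : #|B| <= 1.
  apply/card_le1_eqP => _ _ /imsetP[x xB ->] /imsetP[y yB ->].
  exact: pc.
have := leq_card_setU A B => -[]; lia.
Qed.

(** The complement of a disconnected graph is connected: if [p i] separates [x] and [y], it
    separates any third vertex from one of them, so this vertex shares their common label under
    [p j]. *)
Lemma const_or i j : i != j ->
  {in ~: (S i :|: S j) &, forall x y, p i x = p i y} \/
  {in ~: (S i :|: S j) &, forall x y, p j x = p j y}.
Proof.
move=> ij; set W := ~: _.
have [/forall_inP h | ] := boolP [forall x in W, forall y in W, p i x == p i y].
  by left=> x y xW yW; apply/eqP; move/forall_inP: (h x xW); apply.
case/forall_inPn => x xW /forall_inPn[y yW pxy]; right.
have px z : z \in W -> p j z = p j x.
  move=> zW; have inW t : t \in W -> t \notin S i :|: S j by rewrite inE.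
  have [pzx | pzx] := eqVneq (p i z) (p i x); last first.
    by apply: separate pzx => //; apply: inW.
  rewrite (@separate i j x y) ?inW //; apply: (@separate i j) => //; rewrite ?inW //.
  by rewrite pzx.
by move=> u v /px -> /px ->.
Qed.

Lemma const_of_le i j : i != j -> #|S i| <= #|S j| ->
  {in ~: (S i :|: S j) &, forall x y, p i x = p i y}.
Proof.
move=> ij; case: (const_or ij) => // pc; rewrite leqNgt => /negP[].
by apply: lt_of_const; rewrite setUC.
Qed.

Lemma card_inj : injective (fun i => #|S i|).
Proof.
move=> i j eq_ij; apply/eqP; apply: contraT => ij.
by have := lt_of_const (const_of_le ij (eq_leq eq_ij)); rewrite eq_ij ltnn.
Qed.

Lemma ltS_neq i j : #|S i| < #|S j| -> i != j.
Proof. by apply: contraTneq => ->; rewrite ltnn. Qed.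

(* If two larger barriers left different components of [S i] uncovered, all the
   others would lie in [S j :&: S l], while a count of the complements of [S j]
   and [S l] shows that this intersection is too small. *)
Lemma same_component i j l x y :
  #|S i| < #|S j| -> #|S i| < #|S l| ->
  x \notin S i -> x \notin S j -> y \notin S i -> y \notin S l ->
  p i x = p i y.
Proof.
move=> ij il xi xj yi yl; apply/eqP; apply: contraT => pxy.
have cj := const_of_le (ltS_neq ij) (ltnW ij).
have cl := const_of_le (ltS_neq il) (ltnW il).
have outj z : z \notin S i -> z \notin S j -> p i z = p i x.
  by move=> zi zj; apply: cj; rewrite !inE negb_or ?zi ?zj ?xi.
have outl z : z \notin S i -> z \notin S l -> p i z = p i y.
  by move=> zi zl; apply: cl; rewrite !inE negb_or ?zi ?zl ?yi.
have sub1 : p i @: (~: S i) \subset p i x |: (p i y |: p i @: (S j :&: S l)).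
  apply/subsetP => _ /imsetP[z zi ->]; rewrite inE in zi; rewrite !inE.
  have [zj | /(outj _ zi) ->] := boolP (z \in S j); last by rewrite eqxx.
  have [zl | /(outl _ zi) ->] := boolP (z \in S l); last by rewrite eqxx orbT.
  by rewrite imset_f ?orbT // inE zj.
have sub2 : ~: (S j :|: S l) \subset S i.
  apply/subsetP => z; rewrite !inE negb_or => /andP[zj zl].
  by apply: contraNT pxy => zi; rewrite -(outj z) // (outl z).
(* The two inclusions give [#|V| <= #|S j| + #|S l|], whereas each barrier has less than half of the
   vertices. *)
have := many i; have := subset_leq_card sub1; have := subset_leq_card sub2.
have := leq_imset_card (p i) (S j :&: S l); rewrite !cardsU1.
have := cardsUI (S j) (S l); have := cardsC (S j :|: S l).
have := many_setC j; have := many_setC l.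
have := cardsC (S j); have := cardsC (S l); lia.
Qed.

Definition block i := [set z in ~: S i | [forall (j | #|S i| < #|S j|), z \in S j]].

Lemma block_sub i j : #|S i| < #|S j| -> block i \subset S j.
Proof.
by move=> ij; apply/subsetP => z; rewrite inE => /andP[_ /forall_inP]; apply.
Qed.

Lemma card_block i : #|S i| < #|block i|.
Proof.
have [j ij | top] := pickP (fun j => #|S i| < #|S j|); last first.
  have -> : block i = ~: S i; last by have := many_setC i; lia.
  apply/setP => z; rewrite inE andb_idr // => _.
  by apply/forall_inP => j; rewrite top.
(* Take [x] outside [S i] and outside some larger barrier. By [same_component], any vertex outside
   both [S i] and the block has the label of [x], so the block carries all other labels. *)
have /subsetPn[x xj xi] : ~~ (~: S j \subset S i).
  apply/negP => /subset_leq_card; have := many_setC j; lia.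
rewrite inE in xj.
have sub : p i @: (~: S i) \subset p i x |: p i @: block i.
  apply/subsetP => _ /imsetP[z zi ->]; rewrite !inE.
  have [zB | ] := boolP (z \in block i); first by rewrite imset_f ?orbT.
  rewrite inE zi /= => /forall_inPn[l il zl]; rewrite inE in zi.
  by rewrite (same_component il ij zi zl xi xj) eqxx.
have := subset_leq_card sub; rewrite cardsU1.
have := leq_imset_card (p i) (block i); have := many i; lia.
Qed.

(** The larger of the two barriers contains the block of the smaller one and misses its own
    block. *)
Lemma block_disjoint i j : i != j -> [disjoint block i & block j].
Proof.
wlog ij : i j / #|S i| < #|S j| => [th | _].
  move=> nij; have := nij; rewrite -(inj_eq card_inj) neq_ltn => /orP[] lt.
    exact: th.
  by rewrite disjoint_sym; apply: th; rewrite // eq_sym.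
rewrite disjoint_sym disjoints_subset; apply/subsetP => z.
rewrite inE => /andP[zj _]; rewrite inE; apply: contraL zj.
by rewrite in_setC negbK; apply/subsetP/block_sub.
Qed.

Lemma sum_card_block (P : pred 'I_k) :
  \sum_(i | P i) #|block i| = #|\bigcup_(i | P i) block i|.
Proof.
rewrite big_mkcond [in RHS]big_mkcond -sum1_card partition_disjoint_bigcup.
  by apply: eq_bigr => i _; rewrite sum1_card; case: ifP; rewrite ?cards0.
move=> i j ij; case: ifP; case: ifP; rewrite -!setI_eq0 ?set0I ?setI0 // => _ _.
by rewrite setI_eq0 block_disjoint.
Qed.

Lemma sum_barriers_le (P : pred 'I_k) (A : {set V}) :
  (forall i, P i -> block i \subset A) -> \sum_(i | P i) #|S i|.+1 <= #|A|.
Proof.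
move=> sA; apply: (@leq_trans (\sum_(i | P i) #|block i|)).
  by apply: leq_sum => i _; apply: card_block.
by rewrite sum_card_block; apply/subset_leq_card/bigcupsP.
Qed.

Lemma pow2_le_card : 2 ^ k <= #|V|.+1.
Proof.
(* This threshold exceeds every barrier size, so all [k] indices are counted. *)
have le := pow2_le_sum #|V|.+1 card_inj
  (fun j => sum_barriers_le (fun i => @block_sub i j)).
have all i : #|S i| < #|V|.+1 by rewrite ltnS max_card.
rewrite (_ : [set i | _] = setT) ?cardsT ?card_ord in le; last first.
  by apply/setP => i; rewrite !inE all.
apply: leq_trans le _; rewrite ltnS -cardsT; apply: sum_barriers_le => i _.
exact: subsetT.
Qed.

End Barriers.

(** * Upper bound for the complete graph *)

Lemma complete_edgesP n (e : {set complete n}) :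
  reflect (exists x y : 'I_n, x != y /\ e = [set x; y]) (e \in edges (complete n)).
Proof.
rewrite inE; apply: (iffP existsP) => [[x /existsP[y /andP[xy /eqP ->]]]|].
  by exists x, y.
by case=> x [y [xy ->]]; exists x; apply/existsP; exists y; rewrite eqxx andbT.
Qed.

Lemma edge_neq n (x y : 'I_n) : [set x; y] \in edges (complete n) -> x != y.
Proof.
case/complete_edgesP=> a [b [ab /(congr1 (fun A : {set 'I_n} => #|A|))]].
by rewrite !cards2 ab; case: eqVneq.
Qed.

Lemma sub_edges_edges (G : sgraph) (S : subgraph G) : sub_edges S \subset edges G.
Proof. by have /andP[] := valP S. Qed.

Lemma colors_usedP (G : sgraph) (c : coloring G) a :
  reflect (exists2 e, e \in edges G & c e = a) (a \in colors_used c).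
Proof.
rewrite mem_undup; apply: (iffP mapP) => [[e eG ->]|[e eG <-]];
  by exists e; rewrite ?mem_enum // -mem_enum.
Qed.

Lemma perfect_factor n (E : {set {set 'I_n}}) :
  perfect E -> E \subset edges (complete n) ->
  exists2 S : subgraph (complete n),
    S \in factors 1 (complete n) & sub_edges S \subset E.
Proof.
case/perfectP=> f /matchingP[ff fE] f0 EG.
have fx x : f x != x by apply/negP => h; have := in_set0 x; rewrite -f0 inE h.
pose M : {set {set complete n}} := [set [set x; f x] | x : 'I_n].
have ME : M \subset E by apply/subsetP => _ /imsetP[x _ ->]; apply: fE.
have sM : is_subgraph ([set: complete n], M).
  rewrite /is_subgraph (subset_trans ME EG).
  by apply/forall_inP => e _; apply: subsetT.
exists (exist (@is_subgraph (complete n)) _ sM) => //.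
rewrite inE /is_factor eqxx; apply/forallP => v.
apply/cards1P; exists [set v; f v]; apply/setP => e; rewrite !inE.
apply/andP/eqP => [[/imsetP[x _ ->]] | ->]; last first.
  by split; [exact: imset_f | exact: set21].
by rewrite !inE => /orP[] /eqP -> //; rewrite ff setUC.
Qed.

Lemma poly_upper n (c : coloring (complete n)) :
  ~~ odd n -> 0 < n -> polychromatic (factors 1 (complete n)) c ->
  2 ^ size (colors_used c) <= n.
Proof.
move=> evn n_gt0 poly; set k := size _.
pose col (i : 'I_k) := nth 0 (colors_used c) i.
have col_used i : col i \in colors_used c by apply: mem_nth.
pose E i : {set {set 'I_n}} := [set e in edges (complete n) | c e != col i].
(* A perfect matching within [E i] would be a 1-factor without the color [col i]. *)
have nE i : ~~ perfect (E i).
  apply/negP => /perfect_factor[|S SF SE].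
    by apply/subsetP => e; rewrite inE => /andP[].
  have [e /(subsetP SE)] := poly S SF (col i) (col_used i).
  by rewrite inE => /andP[_ /eqP].
have evV : ~~ odd #|'I_n| by rewrite card_ord.
have [S /fin_all_exists[p bar]] :=
  fin_all_exists (fun i => tutte_barrier evV (nE i)).
have colP i x y : x \notin S i -> y \notin S i -> p i x != p i y ->
    c [set x; y] = col i.
  move=> xi yi pxy; have [_ /(_ x y xi yi pxy)] := bar i; rewrite inE.
  have -> : [set x; y] \in edges (complete n).
    by apply/complete_edgesP; exists x, y; split=> //; apply: contraNneq pxy => ->.
  by rewrite negbK => /eqP.
have : 2 ^ k <= #|'I_n|.+1.
  apply: (@pow2_le_card _ _ k S p) => [i|i j x y ij]; first by case: (bar i).
  (* If both labellings separated [x] and [y], the edge between them would have the two distinct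
     colors [col i] and [col j]. *)
  rewrite !inE !negb_or => /andP[xi xj] /andP[yi yj] pi; apply/eqP.
  apply: contraNT ij => pj; have := colP j x y xj yj pj; rewrite (colP i) //.
  by move/eqP; rewrite nth_uniq ?undup_uniq.
rewrite card_ord leq_eqVlt => /orP[/eqP en | //].
(* Since [n.+1] is odd, [2 ^ k = n.+1] forces [k = 0] and then [n = 0]. *)
by case: k en {col col_used E nE S p bar colP} => [|k]; rewrite ?expnS; lia.
Qed.

(** * Lower bound by the ordered coloring *)

Lemma factor_mate n (S : subgraph (complete n)) :
  S \in factors 1 (complete n) ->
  exists2 f : 'I_n -> 'I_n, injective f & forall x, [set x; f x] \in sub_edges S.
Proof.
rewrite inE => /andP[_ /forallP S1].
have [v|f fS] := @fin_all_exists _ _ (fun v w : 'I_n => [set v; w] \in sub_edges S).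
  have /cards1P[e /setP/(_ e)] := S1 v; rewrite !inE eqxx => /andP[eS].
  have /complete_edgesP[x [y [_ exy]]] := subsetP (sub_edges_edges S) _ eS.
  rewrite exy in eS *; rewrite !inE => /orP[] /eqP ->; first by exists y.
  by exists x; rewrite setUC.
have fx x : x != f x by apply: edge_neq; apply: subsetP (sub_edges_edges S) _ (fS x).
exists f => // x y fxy; apply/eqP.
have /cards1P[e /setP fe] := S1 (f x).
have := fe [set x; f x]; have := fe [set y; f y].
rewrite !inE !fS fxy !eqxx !orbT => /esym/eqP <- /esym/eqP/setP/(_ x).
by rewrite !inE eqxx -fxy (negPf (fx x)) !orbF => <-.
Qed.

Lemma card_ord_last n m : m <= n -> #|[set i : 'I_n | n - i <= m]| = m.
Proof.
move=> mn; rewrite -sum1dep_card.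
rewrite (eq_bigl (fun i : 'I_n => n - m <= i)) => [|i]; last first.
  by apply/idP/idP; have := ltn_ord i; lia.
rewrite -(big_mkord (fun i => n - m <= i) (fun _ => 1)).
rewrite -(big_nat_widenl (n - m) 0 n xpredT) // sum_nat_const_nat; lia.
Qed.

Section Ordered.

Variable n : nat.
Let k := trunc_log 2 n.

(* The cap [k.-1] merges the first vertices, where [n - i] exceeds [2 ^ k - 1],
   into the last color. *)
Definition ordered_coloring : coloring (complete n) :=
  fun e => minn (trunc_log 2 (n - \max_(i in e) (i : 'I_n))) k.-1.

Lemma ordered_coloring2 (x y : 'I_n) a : x != y -> a < k ->
  2 ^ a <= n - maxn x y < 2 ^ a.+1 -> ordered_coloring [set x; y] = a.
Proof.
move=> xy ak /trunc_log_eq h; rewrite /ordered_coloring.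
rewrite big_setU1 ?inE //= big_set1 h //; lia.
Qed.

Lemma ordered_coloring_factor S a : S \in factors 1 (complete n) -> a < k ->
  exists2 e, e \in sub_edges S & ordered_coloring e = a.
Proof.
move=> /factor_mate[f f_inj fS] ak.
have n_gt0 : 0 < n by move: ak; rewrite /k; case: (n).
have le_n : 2 ^ a.+1 <= n.
  apply: leq_trans (trunc_logP (isT : 1 < 2) n_gt0); exact: leq_pexp2l.
(* [A m] consists of the last [m.-1] vertices. The difference of [A (2 ^ a.+1)] and [A (2 ^ a)] is
   the block of color [a]; its [2 ^ a] vertices cannot be mapped injectively to their [2 ^ a - 1]
   followers. *)
pose A m := [set i : 'I_n | n - i <= m.-1].
have /subsetPn[_ /imsetP[x xB ->] fxA] :
    ~~ (f @: (A (2 ^ a.+1) :\: A (2 ^ a)) \subset A (2 ^ a)).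
  apply/negP => /subset_leq_card; rewrite card_imset // leqNgt => /negP[].
  have := cardsID (A (2 ^ a)) (A (2 ^ a.+1)).
  have := subset_leq_card (subsetIr (A (2 ^ a.+1)) (A (2 ^ a))).
  rewrite !card_ord_last; have := expn_gt0 2 a; rewrite expnS in le_n *; lia.
(* As [f x] is not a follower, the last end of this edge lies in the block. *)
exists [set x; f x] => //; apply: ordered_coloring2 => //.
  exact/edge_neq/(subsetP (sub_edges_edges S))/fS.
move: xB fxA; rewrite !inE; have := expn_gt0 2 a; rewrite expnS.
have := ltn_ord x; have := ltn_ord (f x); lia.
Qed.

Lemma mem_ordered_colors a : 1 < n -> (a \in colors_used ordered_coloring) = (a < k).
Proof.
move=> n_gt1; have k_gt0 : 0 < k by rewrite trunc_log_gt0.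
apply/colors_usedP/idP => [[e _ <-] | ak].
  by rewrite /ordered_coloring; lia.
(* The witness joins vertex [n - 2 ^ a] to vertex 0; strictness keeps the two distinct. *)
have lt_n : 2 ^ a < n.
  apply: leq_trans (trunc_logP (isT : 1 < 2) (ltnW n_gt1)); by rewrite ltn_exp2l.
have a_gt0 := expn_gt0 2 a.
have xn : n - 2 ^ a < n by lia.
pose x := Ordinal xn; pose y := Ordinal (ltnW n_gt1).
have xy : x != y by rewrite -val_eqE /=; lia.
exists [set x; y]; first by apply/complete_edgesP; exists x, y.
by apply: ordered_coloring2 => //=; rewrite expnS; lia.
Qed.

End Ordered.

Theorem theorem1 (n : nat) (n_gt0 : 0 < n) (n_even : ~~ odd n) :
  is_poly_number (factors 1 (complete n)) (trunc_log 2 n).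
Proof.
have n_gt1 : 1 < n by lia.
split=> [|c polyc]; last by apply: trunc_log_max => //; apply: poly_upper.
exists (@ordered_coloring n) => [S SF a|].
  by rewrite mem_ordered_colors //; apply: ordered_coloring_factor.
rewrite -[RHS](size_iota 0); apply: perm_size; apply: uniq_perm.
- exact: undup_uniq.
- exact: iota_uniq.
by move=> a; rewrite mem_ordered_colors // mem_iota.
Qed.
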